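(* Let $1<p<\infty$, $1/p+1/q=1$, and let $Z=\{z_k\}$ be a sequence in $\mathbb{D}$. Then $Z$ is weakly separated by $\mathscr{M}_p$ if and only if $$\inf_{j\ne k}\rho_p(z_j,z_k)>0.$$
   Context: $\mathbb{D}$ is the open unit disk in $\mathbb{C}$. $\ell^p_A$ is the space of analytic functions $f(z)=\sum_{n\ge0}a_nz^n$ on $\mathbb{D}$ with $\|f\|_p:=(\sum_n|a_n|^p)^{1/p}<\infty$. Its multiplier algebra is $\mathscr{M}_p:=\{\varphi\in\ell^p_A:\varphi f\in\ell^p_A\ \forall f\in\ell^p_A\}$ with norm $\|\varphi\|_{\mathscr{M}_p}=\sup\{\|\varphi f\|_p:f\in\ell^p_A,\ \|f\|_p=1\}$. A sequence $Z=\{z_0,z_1,\ldots\}\subseteq\mathbb{D}$ is weakly separated by $\mathscr{M}_p$ if there exists $\epsilon>0$ such that, whenever $i\ne j$, there exists $\varphi_{ij}\in\mathscr{M}_p$ with $\|\varphi_{ij}\|_{\mathscr{M}_p}\le1$, $\varphi_{ij}(z_i)=\epsilon$ and $\varphi_{ij}(z_j)=0$. For $\alpha=re^{i\theta}\in\mathbb{C}$ and $s>0$, $\alpha^{\langle s\rangle}:=r^se^{-i\theta}$ (with $0^{\langle s\rangle}=0$). For $z_1,z_2\in\mathbb{D}$, $$\rho_p(z_1,z_2):=\left|\frac{z_1-z_2}{1-z_2^{\langle q-1\rangle}z_1}\right|.$$ *)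

(* Defs.v *)
From mathcomp Require Import all_boot all_order all_algebra.
From mathcomp Require Import complex.
From mathcomp Require Import all_classical all_reals all_analysis.

Set Implicit Arguments.
Unset Strict Implicit.
Unset Printing Implicit Defensive.

Import Order.TTheory GRing.Theory Num.Theory.
Import numFieldNormedType.Exports.
Import ComplexField.Normc.

Local Open Scope classical_set_scope.
Local Open Scope ring_scope.
Local Open Scope complex_scope.

Definition unit_disk (R : realType) : set R[i] := [set z | normc z < 1].
Arguments unit_disk : clear implicits.

(* Functions on the disk are represented by total functions R[i] -> R[i];
   everything below only depends on their values on [unit_disk R]. *)
Definition has_power_series (R : realType) (f : R[i] -> R[i])
    (a : nat -> R[i]) : Prop :=
  forall z, unit_disk R z ->
    series (fun n => a n * z ^+ n : R[i]^o) @ \oo --> (f z : R[i]^o).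

(* The Taylor coefficients are unique when they exist, so the choice made by
   [xget] is forced; the default value is used only if f is not analytic. *)
Definition taylor (R : realType) (f : R[i] -> R[i]) : nat -> R[i] :=
  xget (fun=> 0) [set a | has_power_series f a].

Definition analytic_on_disk (R : realType) (f : R[i] -> R[i]) : Prop :=
  exists a, has_power_series f a.

Definition lpA_norm (R : realType) (p : R) (f : R[i] -> R[i]) : \bar R :=
  ((\sum_(0 <= n <oo) (normc (taylor f n) `^ p)%:E) `^ p^-1)%E.

Definition lpA (R : realType) (p : R) : set (R[i] -> R[i]) :=
  [set f | analytic_on_disk f /\ (lpA_norm p f < +oo)%E].

Definition multiplier (R : realType) (p : R) : set (R[i] -> R[i]) :=
  [set phi | lpA p phi /\ forall f, lpA p f -> lpA p (fun z => phi z * f z)].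

Definition multiplier_norm (R : realType) (p : R) (phi : R[i] -> R[i]) :
    \bar R :=
  ereal_sup [set lpA_norm p (fun z => phi z * f z) |
             f in [set f | lpA p f /\ lpA_norm p f = 1%E]].

Definition weakly_separated (R : realType) (p : R) (Z : nat -> R[i]) : Prop :=
  exists2 eps : R, 0 < eps & forall i j : nat, i != j ->
    exists phi, [/\ multiplier p phi, (multiplier_norm p phi <= 1)%E,
                    phi (Z i) = eps%:C & phi (Z j) = 0].

(* For alpha = r e^{i theta} with r > 0, e^{-i theta} = conj alpha / r, so this
   is r^s e^{-i theta} (see [cpowE]); it is 0 at alpha = 0 since 0^-1 = 0. *)
Definition cpow (R : realType) (alpha : R[i]) (s : R) : R[i] :=
  (normc alpha `^ s)%:C * (conjc alpha / (normc alpha)%:C).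

Lemma normc_polar (R : realType) (r theta : R) : 0 <= r ->
  normc (r%:C * (cos theta +i* sin theta)) = r.
Proof.
move=> r0; rewrite normcM /= cos2Dsin2 sqrtr1 expr0n addr0.
by rewrite sqrtr_sqr ger0_norm// mulr1.
Qed.

Lemma cpowE (R : realType) (r theta s : R) : 0 < r ->
  cpow (r%:C * (cos theta +i* sin theta)) s =
  (r `^ s)%:C * (cos theta -i* sin theta).
Proof.
move=> r0; rewrite /cpow normc_polar ?ltW//; congr (_ * _).
have r0C : r%:C != 0 by rewrite eq_complex /= negb_and gt_eqF.
apply: (mulIf r0C); rewrite divfK//; simpc.
by rewrite [cos theta * r]mulrC [sin theta * r]mulrC.
Qed.

Lemma cpow0 (R : realType) (s : R) : cpow (0 : R[i]) s = 0.
Proof. by rewrite /cpow conjc0 mul0r mulr0. Qed.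

(* rho_p, written in terms of the conjugate exponent q of p. *)
Definition rho (R : realType) (q : R) (z1 z2 : R[i]) : R :=
  normc ((z1 - z2) / (1 - cpow z2 (q - 1) * z1)).

(* Main.v *)
Require Import Defs.
From mathcomp Require Import all_boot all_order all_algebra.
From mathcomp Require Import complex.
From mathcomp Require Import all_classical all_reals all_analysis.
From mathcomp Require Import ring lra.

(** Both directions compare the two conditions for a single pair of points
    [a] (where the multiplier takes the value [eps]) and [b] (where it
    vanishes), with constants that depend only on [p] and [eps]. The estimates
    are made on coefficient sequences, with the finite Hoelder and Minkowski
    inequalities. The common tool is [pnorm_recursion]: if [h 0 = 0] and
    [h (n+1) = b h n + x n] with [|b| < 1], the triangle inequality applied to
    the recursion gives [|h|_p <= |x|_p / (1 - |b|)]. This is the case needed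
    here of Young's inequality for the convolution of an l^1 sequence with an
    l^p sequence.

    From [rho] to multipliers ([moebius_separates]). Put
    [beta = b^<q-1>]. The function [m z = (z - b) / (1 - beta z)] vanishes at
    [b] and [|m a| = rho q a b]. Since
    [m z = - b + (1 - b beta) z / (1 - beta z)], the recursion lemma bounds the
    multiplier norm of [m] by
    [|b| + (1 - |b|^q) / (1 - |b|^(q-1))]. As [|b|^q = (|b|^(q-1))^p],
    Bernoulli's inequality bounds this by [1 + p], uniformly in [b]. Hence
    a suitable multiple of [m] takes at [a] the value [c / (1 + p)], where [c]
    is a lower bound for [rho].

    From multipliers to [rho] ([multiplier_value_le], [rho_lower_bound]). Let
    [f] be the unit vector for which evaluation at [a] is extremal, that is, a
    multiple of [1 / (1 - a^<q-1> z)]; then [f a] is the l^q norm of the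
    sequence [a^n]. If [phi] has multiplier norm at most 1, [phi a = eps] and
    [phi b = 0], the function [g = phi f] has norm at most 1 and
    [eps f a = g a - g b = sum g_n (a^n - b^n)]. The sequence
    [a^n - b^n] satisfies the recursion with input [(a - b) a^n], so its l^q
    norm is at most [|a - b| / (1 - |b|)] times that of [a^n]. Hoelder's
    inequality then leaves [eps (1 - |b|) <= |a - b|]. Finally
    [1 - beta a = (1 - |b|^q) + beta (b - a)], so by Bernoulli's inequality the
    denominator of [rho] is at most [q (1 - |b|) + |a - b|], which is at most
    [(q / eps + 1) |a - b|]. *)

Set Implicit Arguments.
Unset Strict Implicit.
Unset Printing Implicit Defensive.

Import Order.TTheory GRing.Theory Num.Theory.
Import numFieldNormedType.Exports.
Import ComplexField.Normc.

Local Open Scope classical_set_scope.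
Local Open Scope ring_scope.

(** * The complex modulus and limits of complex sequences *)

Lemma normc_real (R : realType) (x : R) : normc (x%:C)%C = `|x|.
Proof. by rewrite /= expr0n addr0 sqrtr_sqr. Qed.

Lemma norm_complexE (R : realType) (z : complex R) : `|z| = ((normc z)%:C)%C.
Proof. by []. Qed.

Lemma normc_ge0 (R : realType) (z : complex R) : 0 <= normc z.
Proof. by case: z => x y; exact: sqrtr_ge0. Qed.

Lemma normc_opp (R : realType) (z : complex R) : normc (- z) = normc z.
Proof. exact: normcN. Qed.

Lemma normcB (R : realType) (z w : complex R) : normc (z - w) = normc (w - z).
Proof. by rewrite -opprB normc_opp. Qed.

Lemma normcX (R : realType) (z : complex R) (n : nat) :
  normc (z ^+ n) = normc z ^+ n.
Proof. by elim: n => [|n IH]; rewrite ?expr0 ?normc1// !exprS normcM IH. Qed.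

Lemma normcJ (R : realType) (a : complex R) : normc (conjc a) = normc a.
Proof. by case: a => x y /=; rewrite sqrrN. Qed.

Lemma ler_normcD (R : realType) (z w : complex R) :
  normc (z + w) <= normc z + normc w.
Proof. exact: le_normcD. Qed.

Lemma normc_sum (R : realType) (N : nat) (x : nat -> complex R) :
  normc (\sum_(n < N) x n) <= \sum_(n < N) normc (x n).
Proof.
elim: N => [|N IH]; first by rewrite !big_ord0 normc0.
by rewrite !big_ord_recr /= (le_trans (ler_normcD _ _))// lerD2r.
Qed.

(** Reduces convergence in [R[i]], whose norm and balls have complex radii, to
    convergence in the ordered field [R]. *)
Lemma cvg_normcP (R : realType) (u : nat -> complex R) (l : complex R) :
  u @ \oo --> (l : (complex R)^o) <->
  (fun n => normc (u n - l)) @ \oo --> (0 : R).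
Proof.
have cP := @cvgrPdist_lt _ (complex R)^o _ _ eventually_filter u l.
have rP := @cvgr0Pnorm_lt R R _ _ eventually_filter (fun n => normc (u n - l)).
split=> ul.
  apply/rP => e e0.
  have e0C : 0 < (e%:C)%C :> complex R by rewrite ltcR.
  apply: filterS (cP.1 ul _ e0C) => n; rewrite norm_complexE ltcR normcB.
  by rewrite ger0_norm// normc_ge0.
apply/cP => e; rewrite ltcE /= => /andP[/eqP ime re].
apply: filterS (rP.1 ul _ re) => n; rewrite ger0_norm ?normc_ge0// => un.
by rewrite norm_complexE ltcE /= ime eqxx normcB.
Qed.

Lemma cvg_clincomb (R : realType) (u v : nat -> complex R)
    (c d l m : complex R) :
  u @ \oo --> (l : (complex R)^o) -> v @ \oo --> (m : (complex R)^o) ->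
  (fun N => c * u N + d * v N) @ \oo --> (c * l + d * m : (complex R)^o).
Proof.
move=> /cvg_normcP ul /cvg_normcP vm; apply/cvg_normcP.
have lim0 : (fun N => normc c * normc (u N - l) + normc d * normc (v N - m))
    @ \oo --> (0 : R).
  have -> : 0 = normc c * 0 + normc d * 0 :> R by rewrite !mulr0 addr0.
  apply: cvgD; first by apply: cvgM ul; exact: cvg_cst.
  by apply: cvgM vm; exact: cvg_cst.
apply: (@squeeze_cvgr _ _ _ _ (fun=> 0) _ _ _ _ _ lim0).
  apply: nearW => N; rewrite normc_ge0 /= -!normcM.
  have -> : c * u N + d * v N - (c * l + d * m) =
    c * (u N - l) + d * (v N - m) by ring.
  exact: ler_normcD.
exact: cvg_cst.
Qed.
Arguments cvg_clincomb {R u v} c d {l m}.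

Lemma normc_le_lim (R : realType) (u : nat -> complex R) (l : complex R)
    (B : R) :
  (forall N, normc (u N) <= B) -> u @ \oo --> (l : (complex R)^o) ->
  normc l <= B.
Proof.
move=> uB /cvg_normcP/cvgr0Pnorm_lt ul; apply/ler_addgt0Pr => e e0.
have [N _ /(_ N (leqnn N))] := ul _ e0.
rewrite /= ger0_norm ?normc_ge0// normcB => lN.
have -> : l = u N + (l - u N) by ring.
by apply: le_trans (ler_normcD _ _) _; apply: lerD => //; exact: ltW.
Qed.

Lemma cpowers_cvg0 (R : realType) (h : nat -> complex R) (M : R)
    (z : complex R) : (forall n, normc (h n) <= M) -> normc z < 1 ->
  (fun n => h n * z ^+ n) @ \oo --> (0 : (complex R)^o).
Proof.
move=> hM z1; apply/cvg_normcP.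
have Mz : (fun n => M * normc z ^+ n) @ \oo --> (0 : R).
  rewrite -[X in _ --> X](mulr0 M); apply: cvgM; first exact: cvg_cst.
  by apply: cvg_expr; rewrite ger0_norm ?normc_ge0.
apply: (@squeeze_cvgr _ _ _ _ (fun=> 0) (fun n => M * normc z ^+ n)) => //.
  apply: nearW => n; rewrite normc_ge0 /= subr0 normcM.
  by rewrite normcX ler_wpM2r ?exprn_ge0 ?normc_ge0.
exact: cvg_cst.
Qed.

Lemma normcM_lt1 (R : realType) (b z : complex R) :
  normc b < 1 -> normc z < 1 -> normc (b * z) < 1.
Proof.
move=> b1 z1; rewrite normcM; apply: le_lt_trans b1.
by rewrite ler_piMr ?normc_ge0// ltW.
Qed.

Lemma sub1_neq0 (R : realType) (w : complex R) : normc w < 1 -> 1 - w != 0.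
Proof.
move=> w1; rewrite subr_eq0; apply: contraTneq w1 => <-.
by rewrite normc1 ltxx.
Qed.

(** * Truncated l^p norms *)

(** Truncating the sequences to [n < N] makes every norm a real number, which
    may be subtracted or cancelled before anything is known about
    summability. *)
Definition pnorm (R : realType) (p : R) (N : nat) (x : nat -> complex R) : R :=
  (\sum_(n < N) normc (x n) `^ p) `^ p^-1.

(** The finite inequalities below are those of the counting measure on [nat]
    for sequences cut off at [N]. *)
Lemma Lnorm_truncation (R : realType) (p : R) (N : nat) (x : nat -> R) :
  0 < p -> ('N[counting]_p%:E[EFin \o (fun n => x n *+ (n < N)%N)%R] =
    ((\sum_(n < N) `|x n| `^ p) `^ p^-1)%R%:E)%E.
Proof.
move=> p0; rewrite Lnorm_counting//.
rewrite (nneseries_split 0 N); last by move=> k _; rewrite lee_fin powR_ge0.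
rewrite add0n eseries0 ?adde0; last first.
  by move=> n /= Nn _; rewrite ltnNge Nn mulr0n normr0 powR0// gt_eqF.
rewrite big_mkord -poweR_EFin -sumEFin; congr (_ `^ _)%E.
by apply: eq_bigr => n _ /=; rewrite ltn_ord mulr1n.
Qed.

Lemma finite_minkowski (R : realType) (p : R) (N : nat) (x y : nat -> R) :
  1 <= p -> (\sum_(n < N) `|x n + y n| `^ p) `^ p^-1 <=
  (\sum_(n < N) `|x n| `^ p) `^ p^-1 + (\sum_(n < N) `|y n| `^ p) `^ p^-1.
Proof.
move=> p1; have p0 : 0 < p by rewrite (lt_le_trans ltr01).
pose T (u : nat -> R) n := u n *+ (n < N)%N.
have TD : T (fun n => x n + y n) = T x \+ T y.
  by apply/funext => n; rewrite /T /= mulrnDl.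
have := @minkowski_EFin _ _ _ (@counting nat R) (T x) (T y) p.
rewrite -TD /T !Lnorm_truncation// -EFinD lee_fin; exact.
Qed.

Lemma finite_hoelder (R : realType) (p q : R) (N : nat) (x y : nat -> R) :
  0 < p -> 0 < q -> p^-1 + q^-1 = 1 ->
  \sum_(n < N) `|x n * y n| <=
  (\sum_(n < N) `|x n| `^ p) `^ p^-1 * (\sum_(n < N) `|y n| `^ q) `^ q^-1.
Proof.
move=> p0 q0 pq; pose T (u : nat -> R) n := u n *+ (n < N)%N.
have TM : T (fun n => x n * y n) = T x \* T y.
  apply/funext => n; rewrite /T /=.
  by case: (n < N)%N; rewrite ?mulr0n ?mulr1n ?mulr0.
have -> : \sum_(n < N) `|x n * y n| =
    (\sum_(n < N) `|x n * y n| `^ 1) `^ 1^-1.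
  rewrite invr1 powRr1; last by apply: sumr_ge0 => i _; exact: powR_ge0.
  by apply: eq_bigr => i _; rewrite powRr1.
have := @hoelder _ _ _ (@counting nat R) (T x) (T y) p q.
rewrite -TM /T !Lnorm_truncation// -EFinM lee_fin; exact.
Qed.

Lemma sum_normc_powR_ge0 (R : realType) (p : R) (N : nat)
    (x : nat -> complex R) :
  0 <= \sum_(n < N) normc (x n) `^ p.
Proof. by apply: sumr_ge0 => n _; exact: powR_ge0. Qed.

Lemma pnorm_ge0 (R : realType) (p : R) (N : nat) (x : nat -> complex R) :
  0 <= pnorm p N x.
Proof. exact: powR_ge0. Qed.

Lemma pnorm_le (R : realType) (p B : R) (N : nat) (x : nat -> complex R) :
  0 < p -> 0 <= B ->
  (pnorm p N x <= B) = (\sum_(n < N) normc (x n) `^ p <= B `^ p).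
Proof.
move=> p0 B0; apply/idP/idP => h.
  have := ge0_ler_powR (ltW p0) (pnorm_ge0 _ _ _) B0 h.
  by rewrite -powRrM mulVf ?gt_eqF// powRr1// sum_normc_powR_ge0.
have pV0 : 0 <= p^-1 by rewrite invr_ge0 ltW.
have := ge0_ler_powR pV0 (sum_normc_powR_ge0 _ _ _) (powR_ge0 _ _) h.
by rewrite -[in X in _ <= X -> _]powRrM mulfV ?gt_eqF// powRr1.
Qed.

Lemma pnormD (R : realType) (p : R) (N : nat) (x y : nat -> complex R) :
  1 <= p -> pnorm p N (fun n => x n + y n) <= pnorm p N x + pnorm p N y.
Proof.
move=> p1; have p0 : 0 < p by rewrite (lt_le_trans ltr01).
have := finite_minkowski N (@normc R \o x) (@normc R \o y) p1.
have nE (z : complex R) : `|normc z| = normc z by rewrite ger0_norm ?normc_ge0.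
under [in X in _ <= X + _ -> _]eq_bigr do rewrite /= nE.
under [in X in _ <= _ + X -> _]eq_bigr do rewrite /= nE.
apply: le_trans; rewrite -/(pnorm _ _ _) pnorm_le ?powR_ge0//.
rewrite -powRrM mulVf ?gt_eqF// powRr1; last first.
  by apply: sumr_ge0 => n _; exact: powR_ge0.
apply: ler_sum => n _; apply: ge0_ler_powR; rewrite ?nnegrE ?normc_ge0//.
  exact: ltW.
by rewrite ger0_norm ?addr_ge0 ?normc_ge0//; exact: ler_normcD.
Qed.

Lemma pnormZ (R : realType) (p : R) (N : nat) (c : complex R)
    (x : nat -> complex R) :
  0 < p -> pnorm p N (fun n => c * x n) = normc c * pnorm p N x.
Proof.
move=> p0; rewrite /pnorm.
under eq_bigr do rewrite normcM powRM ?normc_ge0//.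
rewrite -mulr_sumr powRM ?powR_ge0 ?sum_normc_powR_ge0//.
by rewrite -powRrM mulfV ?gt_eqF// powRr1 ?normc_ge0.
Qed.

Lemma pnorm_hoelder (R : realType) (p q : R) (N : nat)
    (x y : nat -> complex R) :
  0 < p -> 0 < q -> p^-1 + q^-1 = 1 ->
  normc (\sum_(n < N) x n * y n) <= pnorm p N x * pnorm q N y.
Proof.
move=> p0 q0 pq; apply: le_trans (normc_sum N (fun n => x n * y n)) _.
have := finite_hoelder N (@normc R \o x) (@normc R \o y) p0 q0 pq.
have nE (z : complex R) : `|normc z| = normc z by rewrite ger0_norm ?normc_ge0.
under [in X in _ <= X * _ -> _]eq_bigr do rewrite /= nE.
under [in X in _ <= _ * X -> _]eq_bigr do rewrite /= nE.
by under [in X in X <= _ -> _]eq_bigr do rewrite /= -normcM nE.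
Qed.

Lemma pnorm_leS (R : realType) (p : R) (N : nat) (x : nat -> complex R) :
  0 < p -> pnorm p N x <= pnorm p N.+1 x.
Proof.
move=> p0; rewrite pnorm_le ?pnorm_ge0// /pnorm -powRrM mulVf ?gt_eqF//.
by rewrite powRr1 ?sum_normc_powR_ge0// big_ord_recr /= lerDl powR_ge0.
Qed.

Lemma normc_le_pnorm (R : realType) (p : R) (N : nat) (x : nat -> complex R) :
  0 < p -> normc (x N) <= pnorm p N.+1 x.
Proof.
move=> p0; have := lexx (pnorm p N.+1 x).
rewrite pnorm_le ?pnorm_ge0// big_ord_recr /= => h.
have pV0 : 0 <= p^-1 by rewrite invr_ge0 ltW.
have {}h : normc (x N) `^ p <= pnorm p N.+1 x `^ p.
  by rewrite (le_trans _ h)// lerDr sum_normc_powR_ge0.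
have := ge0_ler_powR pV0 (powR_ge0 _ _) (powR_ge0 _ _) h.
rewrite -powRrM mulfV ?gt_eqF// powRr1 ?normc_ge0// -powRrM mulfV ?gt_eqF//.
by rewrite powRr1 ?pnorm_ge0.
Qed.

(** As [h 0 = 0], the norm of [h] up to [N + 1] is the norm of the shifted
    sequence [b h n + x n] up to [N], hence at most [|b| |h| + |x|]; the first
    term is absorbed on the left. *)
Lemma pnorm_recursion (R : realType) (p : R) (b : complex R)
    (x h : nat -> complex R) (N : nat) :
  1 <= p -> normc b < 1 -> h 0%N = 0 ->
  (forall n, h n.+1 = b * h n + x n) ->
  pnorm p N h <= pnorm p N x / (1 - normc b).
Proof.
move=> p1 b1 h0 hS; have p0 : 0 < p by rewrite (lt_le_trans ltr01).
rewrite ler_pdivlMr ?subr_gt0// mulrBr mulr1 lerBlDr addrC.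
have -> : pnorm p N h * normc b = pnorm p N (fun n => b * h n).
  by rewrite pnormZ// mulrC.
apply: le_trans (pnormD _ _ _ p1).
apply: (le_trans (pnorm_leS _ _ p0)).
rewrite /pnorm big_ord_recl h0 normc0 powR0 ?gt_eqF// add0r.
by under eq_bigr do rewrite lift0 hS.
Qed.

(** The input [(a - b) a^n] drives the recursion because
    [a^(n+1) - b^(n+1) = b (a^n - b^n) + (a - b) a^n]. This is the
    l^q form of the Lipschitz estimate for evaluation near [b]. *)
Lemma pnorm_powers_sub (R : realType) (q : R) (a b : complex R) (N : nat) :
  1 <= q -> normc b < 1 ->
  pnorm q N (fun n => a ^+ n - b ^+ n) <=
  normc (a - b) * pnorm q N (fun n => a ^+ n) / (1 - normc b).
Proof.
move=> q1 b1; rewrite -pnormZ ?(lt_le_trans ltr01)//.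
apply: pnorm_recursion => //; first by rewrite !expr0 subrr.
by move=> n; rewrite !exprS; ring.
Qed.

(** * Uniqueness of Taylor coefficients *)

Lemma seriesE (R : realType) (a : nat -> complex R) (z : complex R) (N : nat) :
  series (fun n => a n * z ^+ n : (complex R)^o) N =
  \sum_(n < N) a n * z ^+ n.
Proof. by rewrite /series /= big_mkord. Qed.

Lemma power_series_coef_bound (R : realType) (d : nat -> complex R)
    (z l : complex R) :
  z != 0 ->
  (fun N => \sum_(n < N) d n * z ^+ n) @ \oo --> (l : (complex R)^o) ->
  exists2 M : R, 0 <= M & forall n, normc (d n) <= M / normc z ^+ n.
Proof.
move=> z0 /cvg_normcP dl.
have zn0 : 0 < normc z.
  rewrite lt_neqAle normc_ge0 andbT eq_sym.
  by apply: contraNneq z0 => /eq0_normc->.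
have [K [_ /(_ (`|K| + 1))]] := cvg_seq_bounded (cvgP _ dl).
rewrite (le_lt_trans (ler_norm _)) ?ltrDl// => /(_ isT) HK.
exists (2 * (`|K| + 1)); first by rewrite mulr_ge0// addr_ge0.
move=> n; rewrite ler_pdivlMr ?exprn_gt0// -normcX -normcM.
have -> : d n * z ^+ n = (\sum_(n < n.+1) d n * z ^+ n - l) -
   (\sum_(n < n) d n * z ^+ n - l).
  rewrite big_ord_recr /=; ring.
apply: le_trans (ler_normcD _ _) _; rewrite normc_opp.
have KK m := HK m I; rewrite /= in KK.
rewrite mulrDl mul1r; apply: lerD; [have := KK n.+1|have := KK n];
  by rewrite ger0_norm ?normc_ge0.
Qed.

(** At a small [t > 0] the terms of positive index sum to [O(t)], because the
    coefficients are bounded by [M 2^n] (from convergence at [1/2]). Excluding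
    [z = 0] from the hypothesis makes it stable under division by [z], which
    is what the induction for the other coefficients uses. *)
Lemma power_series_head_eq0 (R : realType) (d : nat -> complex R) :
  (forall z, z != 0 -> normc z < 1 ->
    (fun N => \sum_(n < N) d n * z ^+ n) @ \oo --> (0 : (complex R)^o)) ->
  d 0%N = 0.
Proof.
(* Coefficient bounds come from one fixed point of the disk, here 1/2. *)
move=> d0; have h20 : (2^-1%:C)%C != 0 :> complex R.
  by rewrite eq_complex /= eqxx andbT invr_eq0 pnatr_eq0.
have nh2 : normc (2^-1%:C)%C = 2^-1 :> R.
  by rewrite normc_real ger0_norm ?invr_ge0.
have h21 : normc (2^-1%:C)%C < 1 :> R by rewrite nh2; lra.
have [M M0 dM] := power_series_coef_bound h20 (d0 _ h20 h21).
rewrite nh2 in dM.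
apply: eq0_normc; apply/eqP; rewrite eq_le normc_ge0 andbT.
apply/ler_addgt0Pr => e e0; rewrite add0r.
(* [t] is small enough that the terms of positive index sum to at most
   [4 M t <= e / 2]. *)
pose t := Num.min 4^-1 (e / (8 * (M + 1))).
have t0 : 0 < t.
  by rewrite lt_min invr_gt0 ltr0n/= divr_gt0// mulr_gt0// ltr_wpDl.
have t4 : t <= 4^-1 by rewrite ge_min lexx.
have te : t <= e / (8 * (M + 1)) by rewrite ge_min lexx orbT.
have tz : (t%:C)%C != 0 :> complex R by rewrite eq_complex /= eqxx andbT gt_eqF.
have nt : normc (t%:C)%C = t by rewrite normc_real ger0_norm ?ltW.
have t1 : normc (t%:C)%C < 1 by rewrite nt; lra.
have /cvg_normcP/cvgr0Pnorm_lt := d0 _ tz t1.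
have e2 : 0 < e / 2 by rewrite divr_gt0.
move=> /(_ _ e2)[N _ /(_ N.+1 (leqnSn N))].
rewrite /= subr0 ger0_norm ?normc_ge0// big_ord_recl expr0 mulr1.
set T := \sum_(i < N) _ => dT.
have TB : normc T <= M * 4 * t * (1 - 2^-1 ^+ N).
  rewrite /T; elim: (N) => [|m IH].
    by rewrite big_ord0 normc0 expr0 subrr mulr0.
  rewrite big_ord_recr; apply: le_trans (ler_normcD _ _) _.
  have := dM m.+1; rewrite /= -exprVn invrK => dm.
  have -> : M * 4 * t * (1 - 2^-1 ^+ m.+1) =
    M * 4 * t * (1 - 2^-1 ^+ m) + M * 2 * t * 2^-1 ^+ m.
    by rewrite exprS; field.
  apply: lerD => //; rewrite normcM normcX nt /bump /= add1n exprS.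
  have tm : t ^+ m <= 4^-1 ^+ m.
    by rewrite lerXn2r ?nnegrE ?invr_ge0 ?(ltW t0).
  have := ler_pM (normc_ge0 _) _ dm (ler_wpM2l (ltW t0) tm).
  move=> /(_ (mulr_ge0 (ltW t0) (exprn_ge0 _ (ltW t0)))) /le_trans; apply.
  rewrite exprS le_eqVlt; apply/orP; left; apply/eqP.
  have -> : 4^-1 = 2^-1 * 2^-1 :> R by field.
  rewrite exprMn (_ : 2 ^+ m = (2^-1 ^+ m)^-1); last by rewrite -exprVn invrK.
  by field; rewrite expf_neq0// invr_eq0.
have : normc (d 0%N) <= normc (d 0%N + T) + normc T.
  rewrite -[in X in X <= _](addrK T (d 0%N)).
  by apply: le_trans (ler_normcD _ _) _; rewrite normc_opp.
have MT : M * 4 * t * (1 - 2^-1 ^+ N) <= e / 2.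
  apply: (@le_trans _ _ (M * 4 * t)).
    by rewrite ler_piMr ?mulr_ge0 ?(ltW t0)// gerBl exprn_ge0.
  apply: (@le_trans _ _ (M * 4 * (e / (8 * (M + 1))))).
    by rewrite ler_wpM2l// mulr_ge0.
  have M1 : 0 < M + 1 by rewrite ltr_wpDl.
  have -> : M * 4 * (e / (8 * (M + 1))) = (e / 2) * (M / (M + 1)).
    by field; rewrite gt_eqF.
  by rewrite ler_piMr ?(ltW e2)// ler_pdivrMr// mul1r lerDl.
lra.
Qed.

Lemma power_series_eq0 (R : realType) (d : nat -> complex R) :
  (forall z, z != 0 -> normc z < 1 ->
    (fun N => \sum_(n < N) d n * z ^+ n) @ \oo --> (0 : (complex R)^o)) ->
  forall n, d n = 0.
Proof.
move=> dz n; elim: n d dz => [|n IH] d dz; first exact: power_series_head_eq0.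
apply: (IH (fun n => d n.+1)) => z z0 z1.
have d0 := power_series_head_eq0 dz.
have H := dz z z0 z1.
have {}H : (fun N => \sum_(n < N.+1) d n * z ^+ n) @ \oo -->
    (0 : (complex R)^o).
  by apply: (cvg_comp _ _ _ H); exact: (cvg_addnl 1).
have := cvg_clincomb z^-1 0 H H; rewrite mulr0 mul0r addr0.
apply: cvg_trans; apply: near_eq_cvg; apply: nearW => N.
rewrite mul0r addr0 big_ord_recl d0 mul0r add0r mulr_sumr.
by apply: eq_bigr => i _; rewrite lift0 exprS; field.
Qed.

Lemma has_power_series_unique (R : realType) (f : complex R -> complex R)
    (a b : nat -> complex R) :
  has_power_series f a -> has_power_series f b -> a = b.
Proof.
move=> fa fb; apply/funext => n; apply/eqP; rewrite -subr_eq0; apply/eqP.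
apply: (power_series_eq0 (d := fun n => a n - b n)) => z _ z1.
have := cvg_clincomb 1 (-1) (fa z z1) (fb z z1).
rewrite mulN1r mul1r subrr; apply: cvg_trans.
apply: near_eq_cvg; apply: nearW => N.
rewrite !seriesE mulN1r mul1r -sumrB.
by apply: eq_bigr => i _; rewrite mulrBl.
Qed.

Lemma taylorE (R : realType) (f : complex R -> complex R)
    (a : nat -> complex R) : has_power_series f a -> taylor f = a.
Proof.
move=> fa; apply: (has_power_series_unique (f := f)) => //.
by rewrite /taylor; case: xgetP => [_ _ //|/(_ a)].
Qed.

(** * The norm of l^p_A in terms of truncated norms *)

Lemma lpA_norm_le (R : realType) (p B : R) (f : complex R -> complex R)
    (a : nat -> complex R) : 0 < p -> 0 <= B -> has_power_series f a ->
  (lpA_norm p f <= B%:E)%E <-> forall N, pnorm p N a <= B.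
Proof.
move=> p0 B0 fa; rewrite /lpA_norm (taylorE fa).
set S := (\sum_(0 <= n <oo) _)%E.
have sN N : (\sum_(0 <= n < N) (normc (a n) `^ p)%:E)%E =
    (\sum_(n < N) normc (a n) `^ p)%:E by rewrite big_mkord sumEFin.
have S0 n : (0 <= n)%N -> true -> (0 <= (normc (a n) `^ p)%:E)%E.
  by rewrite lee_fin powR_ge0.
have pV0 : 0 <= p^-1 by rewrite invr_ge0 ltW.
split=> [SB N|aB].
  rewrite -lee_fin (le_trans _ SB)// /pnorm -poweR_EFin.
  apply: gt0_ler_poweR => //; rewrite ?in_itv/= ?leey ?andbT.
  - by rewrite lee_fin sum_normc_powR_ge0.
  - exact: nneseries_ge0.
  - by rewrite -sN; exact: nneseries_lim_ge.
have -> : B%:E = ((B `^ p)%:E `^ p^-1)%E.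
  by rewrite poweR_EFin -powRrM mulfV ?gt_eqF// powRr1.
apply: gt0_ler_poweR => //; rewrite ?in_itv/= ?leey ?andbT.
- exact: nneseries_ge0.
- by rewrite lee_fin powR_ge0.
- apply: lime_le; first exact: is_cvg_nneseries.
  by apply: nearW => N; rewrite sN lee_fin -pnorm_le.
Qed.

Lemma lpAP (R : realType) (p : R) (f : complex R -> complex R) : 0 < p ->
  lpA p f <-> exists a B, [/\ 0 <= B, has_power_series f a &
    forall N, pnorm p N a <= B].
Proof.
move=> p0; split=> [[[a fa] fB]|[a [B [B0 fa aB]]]].
  exists a, (fine (lpA_norm p f)).
  have f0 : (0 <= lpA_norm p f)%E by exact: poweR_ge0.
  have B0 : 0 <= fine (lpA_norm p f) by rewrite fine_ge0.
  split=> //; apply/(lpA_norm_le p0 B0 fa).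
  by rewrite fineK// ge0_fin_numE.
split; first by exists a.
apply: (@le_lt_trans _ _ B%:E); rewrite ?ltry//.
by apply/(lpA_norm_le p0 B0 fa).
Qed.

(** * Moebius-type multipliers *)

(** For [b = cpow a (q - 1)] this is the quotient whose modulus is
    [rho q z a]. *)
Definition moebius (R : realType) (a b : complex R) (z : complex R) :=
  (z - a) / (1 - b * z).

(** The coefficient sequence of [z X(z) / (1 - b z)], where [X] has the
    coefficients [x]. *)
Fixpoint geometric_filter (R : realType) (b : complex R)
    (x : nat -> complex R) (n : nat) : complex R :=
  if n is m.+1 then b * geometric_filter b x m + x m else 0.

(** The partial sums [H_N], [X_N] of the two series satisfy
    [(1 - b z) H_N = z X_N - h_N z^N], and [h_N z^N] tends to 0 because
    [h] is bounded. *)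
Lemma geometric_filter_series (R : realType) (b z : complex R) (M : R)
    (x : nat -> complex R) (l : complex R) :
  normc b < 1 -> normc z < 1 ->
  (forall n, normc (geometric_filter b x n) <= M) ->
  (fun N => \sum_(n < N) x n * z ^+ n) @ \oo --> (l : (complex R)^o) ->
  (fun N => \sum_(n < N) geometric_filter b x n * z ^+ n) @ \oo -->
    ((z * l / (1 - b * z)) : (complex R)^o).
Proof.
move=> b1 z1 hM xl; set h := geometric_filter b x.
have bz0 := sub1_neq0 (normcM_lt1 b1 z1).
have E N : \sum_(n < N) h n * z ^+ n =
    (z * (\sum_(n < N) x n * z ^+ n) - h N * z ^+ N) / (1 - b * z).
  apply: (mulIf bz0); rewrite divfK//.
  elim: N => [|N IH]; first by rewrite !big_ord0 mulr0 /h /= !mul0r subrr.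
  have hS : h N.+1 = b * h N + x N by [].
  by rewrite !big_ord_recr /= mulrDl IH exprS hS; ring.
have := cvg_clincomb (z / (1 - b * z)) (- (1 - b * z)^-1) xl
  (cpowers_cvg0 hM z1).
rewrite mulr0 addr0 mulrAC; apply: cvg_trans; apply: near_eq_cvg.
by apply: nearW => N /=; rewrite E -/h; ring.
Qed.

(** The splitting [(z - a) / (1 - b z) = - a + (1 - a b) z / (1 - b z)] is what
    keeps the constant bounded: the factor [1 - a b] compensates
    [1 / (1 - |b|)] when [b = cpow a (q - 1)], whereas estimating
    [(z - a) X] first would lose it. *)
Lemma moebius_mul (R : realType) (p B : R) (a b k : complex R)
    (f : complex R -> complex R) (x : nat -> complex R) :
  1 <= p -> normc b < 1 -> has_power_series f x ->
  (forall N, pnorm p N x <= B) ->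
  exists2 y, has_power_series (fun z => k * moebius a b z * f z) y &
    forall N, pnorm p N y <=
      normc k * (normc a + normc (1 - a * b) / (1 - normc b)) * B.
Proof.
move=> p1 b1 fx xB; have p0 : 0 < p by rewrite (lt_le_trans ltr01).
pose h := geometric_filter b x.
have hB N : pnorm p N h <= B / (1 - normc b).
  apply: le_trans (pnorm_recursion (x := x) _ p1 b1 _ _) _ => //.
  by rewrite ler_wpM2r// invr_ge0 subr_ge0 ltW.
pose y n := k * (- a * x n + (1 - a * b) * h n).
exists y => [z z1|N].
  have bz0 := sub1_neq0 (normcM_lt1 b1 z1).
  have xz : (fun N => \sum_(n < N) x n * z ^+ n) @ \oo -->
      (f z : (complex R)^o).
    have := fx z z1; apply: cvg_trans; apply: near_eq_cvg; apply: nearW => N.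
    by rewrite seriesE.
  have hM n : normc (h n) <= B / (1 - normc b).
    exact: le_trans (normc_le_pnorm _ _ p0) (hB _).
  have hz := geometric_filter_series b1 z1 hM xz.
  have -> : k * moebius a b z * f z =
      k * (- a * f z + (1 - a * b) * (z * f z / (1 - b * z))).
    by rewrite /moebius; field.
  have := cvg_clincomb (k * - a) (k * (1 - a * b)) xz hz.
  rewrite -!mulrA -mulrDr; apply: cvg_trans; apply: near_eq_cvg.
  apply: nearW => N; rewrite seriesE !mulr_sumr -big_split /=.
  by apply: eq_bigr => i _; rewrite /y -/h; ring.
rewrite /y pnormZ// -mulrA ler_wpM2l ?normc_ge0//.
apply: le_trans (pnormD _ _ _ p1) _; rewrite !pnormZ// mulrDl.
rewrite normc_opp; apply: lerD.
  by rewrite ler_wpM2l ?normc_ge0.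
by rewrite -mulrA ler_wpM2l ?normc_ge0// mulrC hB.
Qed.

(** * Conjugate exponents and the power a^<s> *)

Lemma powR_lt1 (R : realType) (x p : R) :
  0 < p -> 0 <= x -> x < 1 -> x `^ p < 1.
Proof.
by move=> p0 x0 x1; have := gt0_ltr_powR p0 x0 ler01 x1; rewrite powR1.
Qed.

(** Young's inequality for the product [t * 1]. *)
Lemma bernoulli_powR (R : realType) (p t : R) : 1 < p -> 0 <= t ->
  1 - t `^ p <= p * (1 - t).
Proof.
move=> p1 t0; have p0 : 0 < p by rewrite (lt_trans ltr01).
have pV1 : p^-1 < 1 by rewrite invf_lt1.
have := @conjugate_powR R t 1 p (1 - p^-1)^-1 t0 ler01 p0 _ _.
rewrite invr_gt0 subr_gt0 invrK subrKC powR1 mul1r mulr1 => /(_ pV1 erefl).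
rewrite -(ler_pM2l p0) mulrDr mulrCA mulfV ?gt_eqF// mulr1.
by rewrite mulrBr mulr1 mulfV ?gt_eqF//; lra.
Qed.

Lemma conjugate_gt1 (R : realType) (p q : R) :
  1 < p -> p^-1 + q^-1 = 1 -> 1 < q.
Proof.
move=> p1 pq; have p0 : 0 < p by rewrite (lt_trans ltr01).
have pV1 : p^-1 < 1 by rewrite invf_lt1.
have pV0 : 0 < p^-1 by rewrite invr_gt0.
have qE : q^-1 = 1 - p^-1 by rewrite -pq addrAC subrr add0r.
have q0 : 0 < q by rewrite -invr_gt0 qE subr_gt0.
by rewrite -(invf_lt1 q0) qE gtrBl.
Qed.

Lemma conjugate_mul_sub1 (R : realType) (p q : R) :
  1 < p -> p^-1 + q^-1 = 1 -> (q - 1) * p = q.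
Proof.
move=> p1 pq; have q1 := conjugate_gt1 p1 pq.
have p0 : p != 0 by rewrite gt_eqF// (lt_trans ltr01).
have q0 : q != 0 by rewrite gt_eqF// (lt_trans ltr01).
have : (p^-1 + q^-1) * (p * q) = p * q by rewrite pq mul1r.
rewrite mulrDl mulrA mulVf// mul1r (mulrC p q) mulrA mulVf// mul1r => e.
by rewrite mulrBl mul1r -e; ring.
Qed.

Lemma normc_cpow (R : realType) (a : complex R) (s : R) : 0 < s ->
  normc (cpow a s) = normc a `^ s.
Proof.
move=> s0; have [->|a0] := eqVneq a 0.
  by rewrite cpow0 normc0 powR0// gt_eqF.
rewrite /cpow !normcM normcV !normc_real normcJ.
rewrite !ger0_norm ?powR_ge0 ?normc_ge0// divff ?mulr1//.
by apply: contra_neq a0 => /eq0_normc.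
Qed.

Lemma cpow_mul (R : realType) (a : complex R) (s : R) : 0 < s ->
  cpow a s * a = ((normc a `^ (s + 1))%:C)%C.
Proof.
move=> s0; have [->|a0] := eqVneq a 0.
  by rewrite cpow0 mul0r normc0 powR0// gt_eqF// addr_gt0.
have na0 : normc a != 0 by apply: contra_neq a0 => /eq0_normc.
have naC : ((normc a)%:C)%C != 0 :> complex R.
  by rewrite eq_complex /= eqxx andbT.
rewrite powRD; last by rewrite na0 implybT.
rewrite powRr1 ?normc_ge0// rmorphM /= /cpow -mulrA; congr (_ * _).
rewrite mulrAC; apply: (mulIf naC); rewrite divfK//.
rewrite mulrC -(sqr_normc a) expr2 norm_complexE//.
Qed.

(** * Geometric sequences and extremal functions *)

Lemma pnorm_geometric (R : realType) (p : R) (c : complex R) (N : nat) :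
  0 < p -> normc c < 1 ->
  pnorm p N (fun n => c ^+ n) =
    ((1 - (normc c `^ p) ^+ N) / (1 - normc c `^ p)) `^ p^-1.
Proof.
move=> p0 c1; have s1 : normc c `^ p < 1 by rewrite powR_lt1 ?normc_ge0.
rewrite /pnorm; congr (_ `^ _).
have s0 : 1 - normc c `^ p != 0 by rewrite gt_eqF// subr_gt0.
apply: (mulIf s0); rewrite divfK//; elim: N => [|N IH].
  by rewrite big_ord0 mul0r expr0 subrr.
rewrite big_ord_recr /=.
have -> : normc (c ^+ N) `^ p = (normc c `^ p) ^+ N.
  rewrite normcX; elim: N {IH} => [|n IHn]; first by rewrite !expr0 powR1.
  by rewrite !exprS powRM ?exprn_ge0 ?normc_ge0// IHn.
by rewrite mulrDl IH exprS; ring.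
Qed.

Lemma has_power_series_geometric (R : realType) (k c : complex R) :
  normc c < 1 ->
  has_power_series (fun z => k / (1 - c * z)) (fun n => k * c ^+ n).
Proof.
move=> c1 z z1; have cz0 := sub1_neq0 (normcM_lt1 c1 z1).
have c0 : (fun N => (c ^+ N) * z ^+ N) @ \oo --> (0 : (complex R)^o).
  apply: (@cpowers_cvg0 _ _ 1) => // n.
  by rewrite normcX exprn_ile1 ?normc_ge0 ?ltW.
have one : (fun _ : nat => 1) @ \oo --> (1 : (complex R)^o) by exact: cvg_cst.
have := cvg_clincomb (k / (1 - c * z)) (- (k / (1 - c * z))) one c0.
rewrite mulr1 mulr0 addr0; apply: cvg_trans; apply: near_eq_cvg.
apply: nearW => N; rewrite seriesE.
apply: (mulIf cz0); elim: N => [|N IH].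
  by rewrite big_ord0 !expr0 !mulr1 subrr.
rewrite big_ord_recr /= [RHS]mulrDl -IH !exprS.
by field.
Qed.

(** For [c = cpow a (q - 1)] this is the normalized extremal function of the
    evaluation at [a]: there [|c|^p = |a|^q] and [1 - c a = 1 - |a|^q]. *)
Lemma lpA_norm_extremal (R : realType) (p : R) (c : complex R) :
  0 < p -> normc c < 1 ->
  let f := fun z => (((1 - normc c `^ p) `^ p^-1)%:C)%C / (1 - c * z) in
  lpA p f /\ lpA_norm p f = 1%E.
Proof.
move=> p0 c1 f; have s1 : normc c `^ p < 1 by rewrite powR_lt1 ?normc_ge0.
set s := normc c `^ p in f s1 *; have s0 : 0 <= s by exact: powR_ge0.
have sN0 N : 0 <= 1 - s ^+ N by rewrite subr_ge0 exprn_ile1// ltW.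
have w0 : 0 < 1 - s by rewrite subr_gt0.
have fs : has_power_series f (fun n => (((1 - s) `^ p^-1)%:C)%C * c ^+ n).
  exact: has_power_series_geometric.
have nE N : pnorm p N (fun n => (((1 - s) `^ p^-1)%:C)%C * c ^+ n) =
    (1 - s ^+ N) `^ p^-1.
  rewrite pnormZ// pnorm_geometric// normc_real ger0_norm ?powR_ge0// -/s.
  rewrite -powRM ?divr_ge0 ?(ltW w0)// mulrCA mulfV ?gt_eqF// mulr1//.
have pV0 : 0 <= p^-1 by rewrite invr_ge0 ltW.
have f1 : (lpA_norm p f <= 1%:E)%E.
  apply/(lpA_norm_le p0 ler01 fs) => N; rewrite nE.
  have := ge0_ler_powR pV0 (sN0 N) ler01; rewrite powR1; apply.
  by rewrite gerBl exprn_ge0.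
split; first by split; [exists (fun n => (((1 - s) `^ p^-1)%:C)%C * c ^+ n) |
  rewrite (le_lt_trans f1)// ltry].
apply/eqP; rewrite eq_le f1 /=.
have f0 : (0 <= lpA_norm p f)%E by exact: poweR_ge0.
have fB : lpA_norm p f = (fine (lpA_norm p f))%:E.
  by rewrite fineK// ge0_fin_numE// (le_lt_trans f1)// ltry.
have B0 : 0 <= fine (lpA_norm p f) by rewrite fine_ge0.
rewrite fB lee_fin; set B := fine _ in fB B0 *.
have /(lpA_norm_le p0 B0 fs) nB : (lpA_norm p f <= B%:E)%E by rewrite fB.
have Bp N : 1 - s ^+ N <= B `^ p.
  have := nB N; rewrite nE => nBN.
  have := ge0_ler_powR (ltW p0) (powR_ge0 _ _) B0 nBN.
  by rewrite -powRrM mulVf ?gt_eqF// powRr1.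
(* The truncated norms are [(1 - s^N)^(1/p)]; that the full norm is not smaller
   than 1 comes from the limit of [1 - s^N]. *)
have B1 : 1 <= B `^ p.
  apply/ler_addgt0Pr => e e0.
  have /cvgr0Pnorm_lt/(_ _ e0)[N _ /(_ N (leqnn N))] :
    (fun N => s ^+ N) @ \oo --> (0 : R) by apply: cvg_expr; rewrite ger0_norm.
  rewrite /= ger0_norm ?exprn_ge0// => sN; have := Bp N; lra.
have := ge0_ler_powR pV0 ler01 (powR_ge0 _ _) B1.
by rewrite powR1 -powRrM mulfV ?gt_eqF// powRr1.
Qed.

(** * Weak separation of two points *)

Lemma lpA_norm_mul_le1 (R : realType) (p : R) (phi f : complex R -> complex R) :
  (multiplier_norm p phi <= 1)%E -> lpA p f -> lpA_norm p f = 1%E ->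
  (lpA_norm p (fun z => (phi z * f z)%R) <= 1)%E.
Proof.
by move=> phi1 fp f1; apply: le_trans phi1; apply: ereal_sup_ubound; exists f.
Qed.

(** A Schwarz-type estimate, obtained by testing the multiplier on the extremal
    function of [a]: with [w = 1 - |a|^q], the value of that
    function at [a] is [w^(1/p) / w = w^(-1/q)], exactly the l^q norm of the
    sequence [a^n], so that [w] cancels. *)
Lemma multiplier_value_le (R : realType) (p q eps : R) (a b : complex R)
    (phi : complex R -> complex R) :
  1 < p -> p^-1 + q^-1 = 1 -> 0 < eps -> normc a < 1 -> normc b < 1 ->
  multiplier p phi -> (multiplier_norm p phi <= 1)%E ->
  phi a = (eps%:C)%C -> phi b = 0 ->
  eps * (1 - normc b) <= normc (a - b).
Proof.
move=> p1 pq e0 a1 b1 [_ phiM] phi1 phia phib.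
have p0 : 0 < p by rewrite (lt_trans ltr01).
have q1 := conjugate_gt1 p1 pq.
have q0 : 0 < q by rewrite (lt_trans ltr01).
have s0 : 0 < q - 1 by rewrite subr_gt0.
pose beta := cpow a (q - 1).
have nbeta : normc beta = normc a `^ (q - 1) by rewrite normc_cpow.
have beta1 : normc beta < 1 by rewrite nbeta powR_lt1 ?normc_ge0.
have nbetap : normc beta `^ p = normc a `^ q.
  by rewrite nbeta -powRrM (conjugate_mul_sub1 p1 pq).
have [fp f1] := lpA_norm_extremal p0 beta1.
set f := (X in lpA p X) in fp f1 *; rewrite nbetap in f fp f1 *.
set w := 1 - normc a `^ q in f fp f1 *.
have w0 : 0 < w by rewrite subr_gt0 powR_lt1 ?normc_ge0.
have fa : f a = ((w `^ p^-1 / w)%:C)%C.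
  rewrite /f cpow_mul// subrK -(rmorph1 (real_complex R)) -rmorphB -fmorphV.
  by rewrite -rmorphM.
have [[g gs] _] := phiM _ fp.
have g1 N : pnorm p N g <= 1.
  by move: N; apply/(lpA_norm_le p0 ler01 gs); exact: lpA_norm_mul_le1.
have lim := cvg_clincomb 1 (-1) (gs a a1) (gs b b1).
have bound N : normc (1 * series (fun n => g n * a ^+ n : (complex R)^o) N +
    (-1) * series (fun n => g n * b ^+ n : (complex R)^o) N) <=
    normc (a - b) * w^-1 `^ q^-1 / (1 - normc b).
  rewrite !seriesE mul1r mulN1r -sumrB.
  under eq_bigr do rewrite -mulrBr.
  apply: le_trans (pnorm_hoelder N g (fun n => a ^+ n - b ^+ n) p0 q0 pq) _.
  apply: (@le_trans _ _ (pnorm q N (fun n => a ^+ n - b ^+ n))).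
    by rewrite ler_piMl ?pnorm_ge0.
  apply: le_trans (pnorm_powers_sub _ _ (ltW q1) b1) _.
  rewrite ler_wpM2r ?invr_ge0 ?subr_ge0 ?(ltW b1)// ler_wpM2l ?normc_ge0//.
  rewrite pnorm_geometric// -/w; apply: ge0_ler_powR.
  - by rewrite invr_ge0 ltW.
  - rewrite nnegrE divr_ge0 ?(ltW w0)// subr_ge0 exprn_ile1 ?powR_ge0//.
    by rewrite ltW// powR_lt1 ?normc_ge0.
  - by rewrite nnegrE invr_ge0 ltW.
  - rewrite -[leRHS]mul1r ler_wpM2r ?invr_ge0 ?(ltW w0)//.
    by rewrite gerBl exprn_ge0 ?powR_ge0.
have := normc_le_lim bound lim.
rewrite phia phib mul0r mulr0 addr0 mul1r fa -rmorphM normc_real.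
rewrite ger0_norm; last first.
  by rewrite mulr_ge0 ?divr_ge0 ?powR_ge0 ?(ltW e0) ?(ltW w0).
have -> : w^-1 `^ q^-1 = w `^ p^-1 / w.
  rewrite -[w^-1]powR_inv1 ?(ltW w0)// -powRrM mulN1r.
  have -> : - q^-1 = p^-1 + -1 by rewrite -pq; ring.
  by rewrite powRD// (gt_eqF w0) implybT.
by rewrite ler_pdivlMr ?subr_gt0// mulrAC ler_pM2r// divr_gt0// powR_gt0.
Qed.

(** Passing from [1 - |b|] to the denominator of [rho] costs only the factor
    [q] of Bernoulli's inequality, since
    [1 - cpow b (q - 1) * b = 1 - |b|^q]. *)
Lemma rho_lower_bound (R : realType) (q eps : R) (a b : complex R) :
  1 < q -> 0 < eps -> normc a < 1 -> normc b < 1 ->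
  eps * (1 - normc b) <= normc (a - b) -> eps / (q + eps) <= rho q a b.
Proof.
move=> q1 e0 a1 b1 ab; have q0 : 0 < q by rewrite (lt_trans ltr01).
have s0 : 0 < q - 1 by rewrite subr_gt0.
rewrite /rho; set beta := cpow b (q - 1).
have beta1 : normc beta < 1 by rewrite normc_cpow// powR_lt1 ?normc_ge0.
have den0 : 0 < normc (1 - beta * a).
  rewrite lt_neqAle normc_ge0 andbT eq_sym.
  by apply: contraNneq (sub1_neq0 (normcM_lt1 beta1 a1)) => /eq0_normc->.
rewrite normcM normcV ler_pdivlMr// mulrAC ler_pdivrMr ?addr_gt0//.
have den : normc (1 - beta * a) <= q * (1 - normc b) + normc (a - b).
  have -> : 1 - beta * a = (1 - beta * b) + beta * (b - a) by ring.
  apply: le_trans (ler_normcD _ _) _; apply: lerD.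
    rewrite cpow_mul// subrK -(rmorph1 (real_complex R)) -rmorphB normc_real.
    rewrite ger0_norm; first by rewrite bernoulli_powR ?normc_ge0.
    by rewrite subr_ge0 ltW// powR_lt1 ?normc_ge0.
  by rewrite normcM normcB ler_piMl ?normc_ge0// ltW.
apply: (@le_trans _ _ (eps * (q * (1 - normc b) + normc (a - b)))).
  by rewrite ler_pM2l.
have : q * (eps * (1 - normc b)) <= q * normc (a - b) by rewrite ler_pM2l.
lra.
Qed.

(** With [beta = cpow b (q - 1)] and [t = |beta|], the bound for the multiplier
    norm of [moebius b beta] is [|b| + (1 - t^p) / (1 - t)], hence at most
    [1 + p]. *)
Lemma moebius_separates (R : realType) (p q c : R) (a b : complex R) :
  1 < p -> p^-1 + q^-1 = 1 -> 0 < c -> normc a < 1 -> normc b < 1 ->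
  c <= rho q a b ->
  exists phi, [/\ multiplier p phi, (multiplier_norm p phi <= 1)%E,
    phi a = ((c / (1 + p))%:C)%C & phi b = 0].
Proof.
move=> p1 pq c0 a1 b1 crho; have p0 : 0 < p by rewrite (lt_trans ltr01).
have q1 := conjugate_gt1 p1 pq.
have s0 : 0 < q - 1 by rewrite subr_gt0.
set eps := c / (1 + p); have pp : 0 < 1 + p by rewrite addr_gt0.
have e0 : 0 < eps by rewrite divr_gt0.
pose beta := cpow b (q - 1).
have nbeta : normc beta = normc b `^ (q - 1) by rewrite normc_cpow.
have beta1 : normc beta < 1 by rewrite nbeta powR_lt1 ?normc_ge0.
have rhoE : rho q a b = normc (moebius b beta a) by [].
have m0 : 0 < normc (moebius b beta a) by rewrite -rhoE (lt_le_trans c0).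
pose k : complex R := (eps%:C)%C / moebius b beta a.
pose phi z := k * moebius b beta z.
have kB : normc k * (normc b + normc (1 - b * beta) / (1 - normc beta)) <= 1.
  have kc : normc k <= (1 + p)^-1.
    rewrite /k normcM normcV normc_real (gtr0_norm e0) ler_pdivrMr// /eps mulrC.
    by rewrite ler_pM2l ?invr_gt0// -rhoE.
  have bb : normc b + normc (1 - b * beta) / (1 - normc beta) <= 1 + p.
    apply: lerD; first exact: ltW.
    rewrite (mulrC b) cpow_mul// subrK -(rmorph1 (real_complex R)) -rmorphB.
    rewrite normc_real.
    rewrite ger0_norm; last first.
      by rewrite subr_ge0 ltW// powR_lt1 ?normc_ge0// (lt_trans ltr01).
    rewrite ler_pdivrMr ?subr_gt0// -(conjugate_mul_sub1 p1 pq) powRrM -nbeta.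
    by rewrite bernoulli_powR ?normc_ge0.
  rewrite -[leRHS](@mulVf _ (1 + p)) ?gt_eqF//; apply: ler_pM => //.
    exact: normc_ge0.
  by rewrite addr_ge0 ?divr_ge0 ?normc_ge0 ?subr_ge0// ltW.
have mul f : lpA p f -> lpA p (fun z => phi z * f z).
  move=> /(lpAP _ p0)[x [B [B0 fx xB]]].
  have [y fy yB] := moebius_mul b k (ltW p1) beta1 fx xB.
  apply/(lpAP _ p0); exists y, B; split; [exact: B0 | exact: fy | move=> N].
  by apply: le_trans (yB N) _; rewrite ler_piMl.
exists phi; split.
- have n0 : normc (0 : complex R) `^ p = 0 by rewrite normc0 powR0// gt_eqF.
  (* The constant 1 is the extremal function for c = 0. *)
  have oneE : (fun z : complex R =>
      (((1 - normc (0 : complex R) `^ p) `^ p^-1)%:C)%C / (1 - 0 * z)) = fun=> 1.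
    by apply/funext => z; rewrite n0 subr0 powR1 mul0r subr0 divr1.
  have c01 : normc (0 : complex R) < 1 by rewrite normc0.
  have [one_lpA _] := lpA_norm_extremal p0 c01.
  rewrite /= oneE in one_lpA.
  have phiE : (fun z => phi z * 1) = phi by apply/funext => z; rewrite mulr1.
  by split; [rewrite -phiE; exact: mul one_lpA | exact: mul].
- apply: ge_ereal_sup => _ [f [fp f1] <-].
  have [x [B [B0 fx _]]] := (lpAP _ p0).1 fp.
  have xB : forall N, pnorm p N x <= 1.
    by apply/(lpA_norm_le p0 ler01 fx); rewrite f1.
  have [y fy yB] := moebius_mul b k (ltW p1) beta1 fx xB.
  apply/(lpA_norm_le p0 ler01 fy) => N.
  by apply: le_trans (yB N) _; rewrite mulr1.
- by rewrite /phi /k divfK//; apply: contra_ltN m0 => /eqP->; rewrite normc0.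
- by rewrite /phi /moebius subrr mul0r mulr0.
Qed.

Unset Implicit Arguments.

Theorem theorem6p6 (R : realType) (p q : R) (Z : nat -> complex R)
    (hp : 1 < p) (hpq : p^-1 + q^-1 = 1)
    (hZ : forall k, unit_disk R (Z k)) :
  weakly_separated p Z <->
  0 < inf [set x : R | exists j k : nat, j != k /\ x = rho q (Z j) (Z k)].
Proof.
have p0 : 0 < p by rewrite (lt_trans ltr01).
have q1 := conjugate_gt1 hp hpq.
split=> [[eps e0 sep]|].
  apply: (@lt_le_trans _ _ (eps / (q + eps))).
    by rewrite divr_gt0// addr_gt0// (lt_trans ltr01).
  apply: lb_le_inf; first by exists (rho q (Z 0%N) (Z 1%N)), 0%N, 1%N.
  move=> _ [j [k [jk ->]]]; have [phi [phiM phi1 phij phik]] := sep _ _ jk.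
  apply: rho_lower_bound => //; try exact: hZ.
  exact: multiplier_value_le hp hpq e0 (hZ j) (hZ k) phiM phi1 phij phik.
set c := inf _ => c0; exists (c / (1 + p)).
  by rewrite divr_gt0// addr_gt0.
move=> i j ij; apply: (moebius_separates hp hpq c0 (hZ i) (hZ j)).
apply: ge_inf; last by exists i, j.
by exists 0 => _ [k [l [_ ->]]]; exact: normc_ge0.
Qed.
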